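(* Suppose Assumptions A1 and A2 hold. Let $\{w_k\}$ be generated from an arbitrary $w_0\in\mathbb{R}^d$ by the subsampled Newton iteration $$w_{k+1}=w_k-\alpha_k\,\nabla^2F_{S_k}(w_k)^{-1}\nabla F_{X_k}(w_k),$$ where $|X_k|=\eta^k$ for some fixed $\eta>1$, $|S_k|=\beta\ge 1$ is a fixed integer, and the steplength is constant, $\alpha_k=\alpha=\mu_\beta/L$. Then for all $k\ge 0$, $$\mathbb{E}[F(w_k)-F(w^* )]\le C\hat\rho^{\,k},$$ where $$C=\max\left\{F(w_0)-F(w^* ),\ \frac{v^2L_\beta}{\mu\mu_\beta}\right\},\qquad \hat\rho=\max\left\{1-\frac{\mu\mu_\beta}{2LL_\beta},\ \frac1\eta\right\}.$$
   Context: Setting: $P$ is a probability distribution on input–output pairs $(x,y)$, $f(w;x,y)$ is a smooth loss, and $F(w)=\int f(w;x,y)\,dP(x,y)$ for $w\in\mathbb{R}^d$ (expected risk). Sample points $(x^i,y^i)$, $i=1,2,\dots$, are drawn independently from $P$, and $F_i(w)=f(w;x^i,y^i)$, so that $\mathbb{E}[\nabla F_i(w)]=\nabla F(w)$ and $\mathbb{E}[\nabla^2F_i(w)]=\nabla^2F(w)$. For a finite index set $S$, $\nabla F_S(w)=\frac1{|S|}\sum_{i\in S}\nabla F_i(w)$ and $\nabla^2F_S(w)=\frac1{|S|}\sum_{i\in S}\nabla^2F_i(w)$. At each iteration the gradient sample $X_k$ and Hessian sample $S_k$ are index sets of independently drawn sample points, chosen independently of each other and of the past iterates, so that $\mathbb{E}[\nabla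 F_{X_k}(w_k)\mid w_k]=\nabla F(w_k)$. $w^*$ denotes the unique minimizer of $F$; $\|\cdot\|$ is the Euclidean norm or induced matrix norm; $A\preceq B$ means $B-A$ is symmetric positive semidefinite. Assumption A1: $F$ is twice continuously differentiable; for every positive integer $\beta$ there are constants $0<\mu_\beta\le L_\beta$ such that for every index set $S$ with $|S|=\beta$, $\mu_\beta I\preceq\nabla^2F_S(w)\preceq L_\beta I$ for all $w$; there are constants $0<\bar\mu\le\mu_\beta$ and $L_\beta\le\bar L<\infty$ for all $\beta$; and $\mu I\preceq\nabla^2F(w)\preceq LI$ for all $w$, with $0<\mu\le L<\infty$. Assumption A2: there is $v$ with $\operatorname{tr}(\operatorname{Cov}(\nabla F_i(w)))\le v^2$ for all $w$. *)

(* Defs.v *)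
From HB Require Import structures.
From mathcomp Require Import all_boot all_order all_algebra.
From mathcomp Require Import all_classical all_reals all_analysis.
Set Implicit Arguments. Unset Strict Implicit. Unset Printing Implicit Defensive.
Import Order.TTheory GRing.Theory Num.Theory.
Import numFieldNormedType.Exports.
Local Open Scope ring_scope.

Section Calculus.
Context {R : realType} {d : nat}.
Local Notation V := 'rV[R]_d.

Definition evec (i : 'I_d) : V := delta_mx 0 i.

Definition partial (g : V -> R) (i : 'I_d) : V -> R :=
  fun w => derive g w (evec i).

Definition grad (g : V -> R) (w : V) : V := \row_i partial g i w.
Definition hess (g : V -> R) (w : V) : 'M[R]_d :=
  \matrix_(i, j) partial (partial g j) i w.

Definition C2 (g : V -> R) : Prop :=
  (forall w, differentiable g w) /\
  (forall j w, differentiable (partial g j) w) /\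
  (forall i j, continuous (partial (partial g j) i)).

Definition psd (A : 'M[R]_d) : Prop :=
  A^T = A /\ forall u : V, 0 <= (u *m A *m u^T) 0 0.
Definition mxle (A B : 'M[R]_d) : Prop := psd (B - A).

End Calculus.

Section Stoch.
Context {R : realType} {d : nat} {dT : measure_display} {T : measurableType dT}.
Variable P : probability T R.
Local Notation V := 'rV[R]_d.

Definition Frisk (f : V -> T -> R) (w : V) : R := fine (\int[P]_z (f w z)%:E).

Definition gradS (f : V -> T -> R) (s : seq T) (w : V) : V :=
  (size s)%:R^-1 *: \sum_(z <- s) grad (f^~ z) w.
Definition hessS (f : V -> T -> R) (s : seq T) (w : V) : 'M[R]_d :=
  (size s)%:R^-1 *: \sum_(z <- s) hess (f^~ z) w.

(* one subsampled Newton step: the fresh sample s is split into the gradient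
   sample X = first nX points and the Hessian sample S = remaining points;
   w - alpha * (hessS S w)^{-1} (gradS X w)   (vectors transposed to columns) *)
Definition sn_step (f : V -> T -> R) (alpha : R) (nX : nat) (w : V) (s : seq T) : V :=
  w - alpha *: ((invmx (hessS f (drop nX s) w) *m (gradS f (take nX s) w)^T)^T).

(* expectation of phi(z_1,...,z_m) for z_1,...,z_m drawn i.i.d. from P *)
Fixpoint iint (m : nat) (phi : seq T -> \bar R) : \bar R :=
  match m with
  | 0 => phi [::]
  | m'.+1 => \int[P]_z iint m' (fun s => phi (z :: s))
  end.

(* Eiter m step j n w phi = E[phi(w_{j+n}) | w_j = w] for the Markov chain
   w_{k+1} = step k w_k s_k, with s_k a fresh i.i.d. P-sample of size m k,
   independent of everything else. *)
Fixpoint Eiter (m : nat -> nat) (step : nat -> V -> seq T -> V)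
    (j n : nat) (w : V) (phi : V -> \bar R) : \bar R :=
  match n with
  | 0 => phi w
  | n'.+1 => iint (m j) (fun s => Eiter m step j.+1 n' (step j w s) phi)
  end.

End Stoch.

Definition batch {R : realType} (eta : R) (k : nat) : nat :=
  `|Num.ceil (eta ^+ k)|%N.

(* Main.v *)
(* Write [e] for the error of the sampled gradient, [H] for the sampled Hessian and
   [Delta = F - F wstar]. Taylor's bound with [hess F <= L], the spectral bounds on [H]
   and the Polyak-Lojasiewicz inequality [2 mu Delta <= |grad F|^2] give, for every sample,
     Delta(w+) <= (1 - mu m / (L M)) Delta(w) + u(H) . e + |e|^2 / (2 L)
   with [m = mub beta], [M = Lb beta] and [u(H)] a bounded function of the Hessian sample.
   As [e] is centered and independent of [H], the linear term has mean zero, and the last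
   one has mean at most [v^2 / (2 L n)] for [n] gradient samples. Iterating this affine
   bound and comparing it with [C rho^k] gives the rate.

   Nothing makes [w |-> Eiter ... w phi] measurable. This is harmless: the majorant
   above is measurable, and only its integral has to be computed. *)

Require Import Defs.
From HB Require Import structures.
From mathcomp Require Import all_boot all_order all_algebra.
From mathcomp Require Import all_classical all_reals all_analysis.
From mathcomp Require Import measurable_realfun ring lra.
Import Order.TTheory GRing.Theory Num.Theory.
Import numFieldNormedType.Exports.
Local Open Scope ring_scope.
Local Open Scope classical_set_scope.

(** * The Euclidean inner product and quadratic-form bounds *)

Section DotProduct.
Context {R : realType} {d : nat}.
Implicit Types (x y z : 'rV[R]_d) (A H : 'M[R]_d).

Definition dot x y : R := (x *m y^T) 0 0.

Lemma dotE x y : dot x y = \sum_i x 0 i * y 0 i.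
Proof. by rewrite /dot mxE; apply: eq_bigr => i _; rewrite mxE. Qed.

Lemma dotC x y : dot x y = dot y x.
Proof. by rewrite !dotE; apply: eq_bigr => i _; rewrite mulrC. Qed.

Lemma dotDl x y z : dot (x + y) z = dot x z + dot y z.
Proof. by rewrite /dot mulmxDl mxE. Qed.

Lemma dotDr x y z : dot x (y + z) = dot x y + dot x z.
Proof. by rewrite dotC dotDl !(dotC x). Qed.

Lemma dotZl a x y : dot (a *: x) y = a * dot x y.
Proof. by rewrite /dot -scalemxAl mxE. Qed.

Lemma dotZr a x y : dot x (a *: y) = a * dot x y.
Proof. by rewrite dotC dotZl dotC. Qed.

Lemma dot_ge0 x : 0 <= dot x x.
Proof. by rewrite dotE; apply: sumr_ge0 => i _; rewrite -expr2 sqr_ge0. Qed.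

Lemma sqr_coord_le_dot x i : x 0 i ^+ 2 <= dot x x.
Proof.
rewrite dotE (bigD1 i)//= -expr2 lerDl.
by apply: sumr_ge0 => j _; rewrite -expr2 sqr_ge0.
Qed.

Lemma dot_eq0 x : dot x x <= 0 -> x = 0.
Proof.
move=> x0; apply/rowP => i; rewrite [RHS]mxE; apply/eqP.
by rewrite -sqrf_eq0 eq_le sqr_ge0 andbT (le_trans (sqr_coord_le_dot x i)).
Qed.

Lemma dot_mulmx A x y : dot x (y *m A) = dot (x *m A^T) y.
Proof. by rewrite /dot trmx_mul mulmxA. Qed.

Lemma mxle_scalar_l {m : R} {A} : mxle m%:M A -> forall x, m * dot x x <= dot (x *m A) x.
Proof.
move=> [_ +] x => /(_ x); rewrite mulmxBr mulmxBl mul_mx_scalar -scalemxAl mxE.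
by rewrite [X in _ + X]mxE [X in _ - X]mxE subr_ge0.
Qed.

Lemma mxle_scalar_r {m : R} {A} : mxle A m%:M -> forall x, dot (x *m A) x <= m * dot x x.
Proof.
move=> [_ +] x => /(_ x); rewrite mulmxBr mulmxBl mul_mx_scalar -scalemxAl mxE.
by rewrite [X in _ + X]mxE [X in X - _]mxE subr_ge0.
Qed.

Lemma mxle_scalar_sym {m : R} {A} : mxle m%:M A -> A^T = A.
Proof.
case=> + _; rewrite linearB /= tr_scalar_mx => AB.
by apply: (addIr (- m%:M)).
Qed.

End DotProduct.

(** * Bounds for the inverse of a matrix lying between [m I] and [M I] *)

Section SpectralBounds.
Context {R : realType} {d : nat}.
Variables (m M : R) (H : 'M[R]_d).
Hypotheses (m0 : 0 < m) (mM : m <= M) (lH : mxle m%:M H) (Hu : mxle H M%:M).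
Implicit Types x y : 'rV[R]_d.
Local Notation K := (invmx H).

(** A left kernel vector [x] satisfies [m |x|^2 <= x H x^T = 0], so the kernel is trivial. *)
Lemma mxle_unitmx : H \in unitmx.
Proof.
rewrite -row_free_unit -kermx_eq0; apply/eqP/row_matrixP => i; rewrite row0.
apply: dot_eq0; have := mxle_scalar_l lH (row i (kermx H)).
rewrite -row_mul mulmx_ker row0 {2}/dot mul0mx mxE.
by rewrite pmulr_rle0.
Qed.

Let mulKH x : x *m K *m H = x. Proof. by rewrite mulmxKV// mxle_unitmx. Qed.

Lemma invmx_sym : K^T = K.
Proof. by rewrite trmx_inv (mxle_scalar_sym lH). Qed.

Lemma dot_invmx_ge x : m * dot (x *m K) (x *m K) <= dot x (x *m K).
Proof. by have := mxle_scalar_l lH (x *m K); rewrite mulKH. Qed.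

(* Positivity of the form of [H] at [p - p H / M], with [p = x K]. *)
Lemma dot_le_invmx x : dot x x <= M * dot x (x *m K).
Proof.
have M0 : 0 < M by exact: lt_le_trans m0 mM.
have := mxle_scalar_l lH (x *m K + (- M^-1) *: x).
set a := dot (_ + _) (_ + _) => h.
have {}h : 0 <= dot ((x *m K + (- M^-1) *: x) *m H) (x *m K + (- M^-1) *: x).
  by apply: le_trans h; rewrite mulr_ge0 ?(ltW m0)// dot_ge0.
move: h; rewrite mulmxDl mulKH -scalemxAl !(dotDl, dotDr, dotZl, dotZr).
have -> : dot (x *m H) (x *m K) = dot x x.
  by rewrite -[in LHS](mxle_scalar_sym lH) -dot_mulmx (mxle_scalar_sym lH) mulKH.
move=> h.
have := mxle_scalar_r Hu x; set c := dot (x *m H) x in h * => cM.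
have MV : M^-1 * M = 1 by rewrite mulVf// gt_eqF.
have : M^-1 * (M^-1 * c) <= M^-1 * dot x x.
  by rewrite ler_pM2l ?invr_gt0// mulrC ler_pdivrMr// mulrC.
move: h; set e := dot x (x *m K); set f := dot x x => h1 h2.
rewrite -(@ler_pM2l _ M^-1) ?invr_gt0// mulrA MV mul1r.
by lra.
Qed.

(** With [p = x K], expand [0 <= |x - m p|^2] and bound the cross term by [m |p|^2 <= x . p]. *)
Lemma dot_invmx_le x : m ^+ 2 * dot (x *m K) (x *m K) <= dot x x.
Proof.
have := dot_ge0 (x + (- m) *: (x *m K)).
rewrite !(dotDl, dotDr, dotZl, dotZr) (dotC (x *m K) x).
have := dot_invmx_ge x.
set a := dot x x; set b := dot x _; set c := dot _ _ => h1 h2.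
have : m * (m * c) <= m * b by rewrite ler_pM2l.
by rewrite expr2; lra.
Qed.

(** A row of [K] is the image of a unit vector, so its norm is at most [1 / m]. This makes the noise
    coefficients bounded, hence integrable. *)
Lemma invmx_entry_le i j : `|K i j| <= m^-1.
Proof.
have h := dot_invmx_le (delta_mx 0 i).
rewrite -rowE in h.
have : K i j ^+ 2 <= dot (row i K) (row i K).
  by rewrite (_ : K i j = row i K 0 j) ?sqr_coord_le_dot// mxE.
have {h} : dot (row i K) (row i K) <= m^-1 ^+ 2.
  rewrite -(@ler_pM2l _ (m ^+ 2)) ?exprn_gt0// -exprMn divff ?gt_eqF// expr1n.
  apply: le_trans h _; rewrite dotE (bigD1 i)//= big1 => [|k ki].
    by rewrite !mxE !eqxx mulr1 addr0.
  by rewrite !mxE (negbTE ki) andbF mulr0.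
move=> /[swap] /le_trans /[apply].
by rewrite -ler_sqrt ?sqr_ge0// !sqrtr_sqr (ger0_norm (x := m^-1))// invr_ge0 ltW.
Qed.

End SpectralBounds.

(** * Second-order Taylor bounds and the Polyak-Lojasiewicz inequality *)

Section Taylor.
Context {R : realType} {d : nat}.
Implicit Types (F : 'rV[R]_d -> R) (x y p : 'rV[R]_d).

Lemma diff_grad F x p : differentiable F x -> 'd F x p = dot p (grad F x).
Proof.
move=> dF; rewrite [in LHS](row_sum_delta p) linear_sum dotE /=.
by apply: eq_bigr => i _; rewrite linearZ /= mxE /partial deriveE.
Qed.

Lemma is_derive_line F x p (t : R) : differentiable F (x + t *: p) ->
  is_derive t 1 (fun s : R => F (x + s *: p)) (dot p (grad F (x + t *: p))).
Proof.
move=> dF; have dl : is_diff t (fun s : R => x + s *: p) (fun s : R => s *: p).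
  have -> : (fun s : R => s *: p) = 0 + ( *:%R ^~ p) :> (R -> _).
    by apply/funext => s; rewrite /GRing.add /= add0r.
  exact: (is_diffD (is_diff_cst x t) (is_diff_scalel t p)).
have dc : differentiable (fun s : R => F (x + s *: p)) t.
  by apply: (@differentiable_comp _ _ _ _ (fun s : R => x + s *: p) F).
split; first exact/derivable1_diffP.
rewrite deriveE//.
rewrite (@diff_comp _ _ _ _ (fun s : R => x + s *: p) F)//=.
by rewrite diff_val/= scale1r diff_grad.
Qed.

(** The mean value theorem is used twice: it bounds [h1] by an affine function on [t >= 0], and then
    shows that [h] minus the matching quadratic does not increase from 0 to 1. *)
Lemma second_order_le (h h1 h2 : R -> R) (c : R) :
  (forall t : R, is_derive t 1 h (h1 t)) -> (forall t : R, is_derive t 1 h1 (h2 t)) ->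
  (forall t, h2 t <= c) -> h 1 <= h 0 + h1 0 + c / 2.
Proof.
move=> dh dh1 hc.
have cont (k k1 : R -> R) (a b : R) : (forall t : R, is_derive t 1 k (k1 t)) ->
    {within `[a, b], continuous k}.
  by move=> dk; apply: derivable_within_continuous => t _; exact: ex_derive.
have le1 (t : R) : 0 <= t -> h1 t <= h1 0 + c * t.
  move=> t0; have [s _] := MVT_segment t0 (fun s _ => dh1 s) (cont _ _ 0 t dh1).
  rewrite subr0 => e; rewrite -lerBlDl e.
  by rewrite ler_wpM2r.
pose k (t : R) := h t - h1 0 * t - c / 2 * t ^+ 2.
have dk (t : R) : is_derive t 1 k (h1 t - h1 0 - c * t).
  have D := is_deriveB (is_deriveB (dh t) (is_deriveZ (h1 0) (is_derive_id t 1)))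
    (is_deriveZ (c / 2) (is_deriveM (is_derive_id t 1) (is_derive_id t 1))).
  have -> : k = h - h1 0 *: id - (c / 2) *: (id * id).
    by apply/funext => s; rewrite /k expr2.
  have -> // : h1 t - h1 0 - c * t = h1 t - h1 0 *: 1 - (c / 2) *: (t *: 1 + t *: 1).
  rewrite /GRing.scale /= !mulr1.
  by rewrite -mulr2n -(mulr_natl t 2) mulrA divfK ?pnatr_eq0.
have [s] := MVT_segment ler01 (fun s _ => dk s) (cont _ _ 0 1 dk).
rewrite inE /= => /andP[s0 _]; rewrite subr0 mulr1 /k => e.
by have := le1 _ s0; lra.
Qed.

Section C2.
Variable F : 'rV[R]_d -> R.
Hypothesis F2 : C2 F.

Lemma is_derive_line2 x p (t : R) :
  is_derive t 1 (fun s : R => dot p (grad F (x + s *: p)))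
    (dot (p *m hess F (x + t *: p)) p).
Proof.
have [_ [dp _]] := F2.
have -> : (fun s : R => dot p (grad F (x + s *: p))) =
    \sum_i (p 0 i *: (fun s : R => partial F i (x + s *: p))).
  apply/funext => s; rewrite fct_sumE dotE; apply: eq_bigr => i _.
  by rewrite mxE.
apply: is_derive_eq.
  apply: is_derive_sum => i; apply: is_deriveZ; apply: is_derive_line; exact: dp.
rewrite dotE; apply: eq_bigr => i _; rewrite mulrC; congr (_ * _).
by rewrite dotE mxE; apply: eq_bigr => j _; rewrite !mxE.
Qed.

Lemma taylor_le x p (c : R) : (forall w, dot (p *m hess F w) p <= c) ->
  F (x + p) <= F x + dot p (grad F x) + c / 2.
Proof.
move=> hc; have := @second_order_le (fun s => F (x + s *: p)) _ _ c
  (fun t => is_derive_line F x p t (F2.1 _)) (is_derive_line2 x p) (fun t => hc _).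
by rewrite scale1r scale0r addr0.
Qed.

End C2.

Lemma second_order_ge (h h1 h2 : R -> R) (c : R) :
  (forall t : R, is_derive t 1 h (h1 t)) -> (forall t : R, is_derive t 1 h1 (h2 t)) ->
  (forall t, c <= h2 t) -> h 0 + h1 0 + c / 2 <= h 1.
Proof.
move=> dh dh1 hc.
have : - h 1 <= - h 0 + - h1 0 + - c / 2.
  apply: (second_order_le (- h) (- h1) (- h2) _ (fun t => is_deriveN (dh t))
    (fun t => is_deriveN (dh1 t))) => t.
  by rewrite lerN2.
by lra.
Qed.

Lemma taylor_ge F x p (c : R) : C2 F -> (forall w, c <= dot (p *m hess F w) p) ->
  F x + dot p (grad F x) + c / 2 <= F (x + p).
Proof.
move=> F2 hc; have := @second_order_ge (fun s => F (x + s *: p)) _ _ c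
  (fun t => is_derive_line F x p t (F2.1 _)) (is_derive_line2 F F2 x p) (fun t => hc _).
by rewrite scale1r scale0r addr0.
Qed.

(* Minimising the quadratic lower bound of [F y] over [y]. *)
Lemma polyak_lojasiewicz F (mu : R) x y : C2 F -> 0 < mu ->
  (forall w, mxle mu%:M (hess F w)) ->
  2 * mu * (F x - F y) <= dot (grad F x) (grad F x).
Proof.
move=> F2 mu0 lH; set p := y - x; set g := grad F x.
have := @taylor_ge F x p (mu * dot p p) F2 (fun w => mxle_scalar_l (lH w) p).
have -> : x + p = y by rewrite addrC subrK.
rewrite -/g (dotC p g) => h; clearbody p g.
(* The quadratic lower bound is minimal at [p = - g / mu]; this square measures the distance to that
   minimum. *)
have := dot_ge0 (g + mu *: p).
rewrite !(dotDl, dotDr, dotZl, dotZr) (dotC p g).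
move: h; set a := dot g g; set b := dot g p; set e := dot p p => h1 h2.
have h3 : mu * (F x + b + mu * e / 2) <= mu * F y by rewrite ler_pM2l.
by rewrite mulrDr in h3 *; lra.
Qed.

End Taylor.

(** * Decrease of [F] in one step, for a fixed Hessian sample and gradient error *)

Section NewtonStep.
Context {R : realType} {d : nat}.
Variables (F : 'rV[R]_d -> R) (mu L m M : R).
Hypotheses (F2 : C2 F) (mu0 : 0 < mu) (muL : mu <= L) (m0 : 0 < m) (mM : m <= M).
Hypothesis F_hess : forall w, mxle mu%:M (hess F w) /\ mxle (hess F w) L%:M.

(** Collects the terms of the Taylor bound that are linear in the error [e]. It depends on [H] and
    [w] only, so it is independent of [e]. *)
Definition noise_coef (H : 'M[R]_d) (w : 'rV[R]_d) : 'rV[R]_d :=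
  ((- (m / L)) *: grad F w + (m ^+ 2 / L) *: (grad F w *m invmx H)) *m invmx H.

(** Put [a = m / L], [K = invmx H] and [g = grad F w]. As [L a^2 = m a], the quadratic term
    [m a |g K|^2 / 2] costs at most half of the gain [a g . (g K)]. The other half is at least
    [a |g|^2 / (2 M)], to which Polyak-Lojasiewicz applies. *)
Lemma newton_step_le (H : 'M[R]_d) (w e y : 'rV[R]_d) :
  mxle m%:M H -> mxle H M%:M ->
  F (w - (m / L) *: ((grad F w + e) *m invmx H)) - F y <=
    (1 - mu * m / (L * M)) * (F w - F y)
    + dot e (noise_coef H w) + (2 * L)^-1 * dot e e.
Proof.
move=> lH Hu; have L0 : 0 < L by exact: lt_le_trans muL.
have M0 : 0 < M by exact: lt_le_trans mM.
rewrite /noise_coef dot_mulmx (invmx_sym _ _ lH).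
have h1 := dot_invmx_ge m H m0 lH (grad F w).
have h2 := dot_le_invmx m M H m0 mM lH Hu (grad F w).
have h3 := dot_invmx_le m H m0 lH e.
have h4 := polyak_lojasiewicz F mu w y F2 mu0 (fun w => (F_hess w).1).
have := taylor_le F F2 w (- ((m / L) *: ((grad F w + e) *m invmx H))) _
  (fun z => mxle_scalar_r (F_hess z).2 _).
rewrite mulmxDl -scaleNr !(dotDl, dotDr, dotZl, dotZr).
rewrite (dotC (_ *m _) (grad F w)) (dotC (grad F w *m _) (e *m _)).
rewrite (dotC (e *m _) (grad F w)).
move: h1 h2 h3 h4; set G := grad F w.
set A := dot G (G *m _); set b := dot (G *m _) (G *m _); set q := dot (e *m _) (e *m _).
set GG := dot G G; set ee := dot e e; set X := dot G (e *m _); set Y := dot _ _.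
set a := m / L; have -> : m ^+ 2 / L = m * a by rewrite /a mulrA.
have -> : mu * m / (L * M) = mu * a / M by rewrite /a; field; rewrite !gt_eqF.
have a0 : 0 < a by rewrite divr_gt0.
have La : L * (a * a) = m * a by rewrite /a; field; rewrite gt_eqF.
move=> h1 h2 h3 h4 h5.
have k3 : m * a * q / 2 <= (2 * L)^-1 * ee.
  have -> : m * a * q / 2 = (2 * L)^-1 * (m ^+ 2 * q) by rewrite /a; field; rewrite gt_eqF.
  by rewrite ler_pM2l// invr_gt0 mulr_gt0.
have k1 : a * (m * b) <= a * A by rewrite ler_pM2l.
have k2 : mu * a / M * (F w - F y) <= a * A / 2.
  have -> : mu * a / M * (F w - F y) = a / (2 * M) * (2 * mu * (F w - F y)).
    by field; rewrite gt_eqF.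
  have -> : a * A / 2 = a / (2 * M) * (M * A) by field; rewrite gt_eqF.
  by rewrite ler_pM2l ?divr_gt0 ?mulr_gt0// (le_trans h4).
have {h5} := lerB h5 (lexx (F y)); move/le_trans; apply.
have -> : m * a * Y = L * (a * a) * Y by rewrite La.
move: k1 k3; rewrite -[m * a]La (_ : a * (m * b) = L * (a * a) * b); last by rewrite La; ring.
by move: k2; move: (mu * a / M) ((2 * L)^-1 * ee) => c1 c2; lra.
Qed.

End NewtonStep.

(* The integral of a nonnegative function is a supremum over simple functions
   below it, hence monotone without any measurability assumption. *)
Lemma ge0_le_integral_nonmeas (R : realType) (dT : measure_display)
    (T : measurableType dT) (P : {measure set T -> \bar R}) (f g : T -> \bar R) :
  (forall z, 0 <= f z)%E -> (forall z, f z <= g z)%E ->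
  (\int[P]_z f z <= \int[P]_z g z)%E.
Proof.
move=> f0 fg; rewrite !ge0_integralTE//; last by move=> z; apply: le_trans (fg z).
by apply: ereal_sup_le => _ [h hf <-]; exists h => // z; exact: le_trans (fg z).
Qed.

(** * Means over i.i.d. samples as iterated integrals *)

Section IteratedMean.
Context {R : realType} {dT : measure_display} {T : measurableType dT}.
Variable P : probability T R.
Implicit Types (m n : nat) (phi psi : seq T -> R) (x y : R).

(* [imean m phi x]: all the iterated integrals defining [iint P m phi] exist,
   and their value is [x]. *)
Fixpoint imean m phi x : Prop :=
  match m with
  | 0 => phi [::] = x
  | m'.+1 => exists g : T -> R,
      [/\ forall z, imean m' (fun s => phi (z :: s)) (g z),
          P.-integrable setT (EFin \o g) &
          (\int[P]_z (g z)%:E)%E = x%:E]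
  end.

Lemma integral_cst_probability x : (\int[P]_z x%:E)%E = x%:E.
Proof.
rewrite (integral_cst P measurableT x%:E).
by rewrite -[RHS]mule1; congr mule; exact: probability_setT.
Qed.

Lemma eq_imean m phi psi x :
  (forall s, size s = m -> phi s = psi s) -> imean m phi x -> imean m psi x.
Proof.
elim: m phi psi x => [|m IH] phi psi x e /=; first by rewrite e.
case=> g [h ig Eg]; exists g; split => // z; apply: IH (h z) => s sm.
by apply: e; rewrite /= sm.
Qed.

Lemma imean_cst m x : imean m (fun=> x) x.
Proof.
elim: m => [//|m IH] /=; exists (fun=> x); split => //.
  exact: (finite_measure_integrable_cst P x measurableT).
by rewrite integral_cst_probability.
Qed.

Lemma imeanD m phi psi x y :
  imean m phi x -> imean m psi y -> imean m (fun s => phi s + psi s) (x + y).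
Proof.
elim: m phi psi x y => [|m IH] phi psi x y /=; first by move=> -> ->.
move=> [g [h ig Eg]] [g' [h' ig' Eg']]; exists (fun z => g z + g' z); split.
- by move=> z; exact: IH.
- exact: (integrableD measurableT ig ig').
- by rewrite (integralD_EFin measurableT ig ig') Eg Eg'.
Qed.

Lemma imeanZ m phi x y : imean m phi x -> imean m (fun s => y * phi s) (y * x).
Proof.
elim: m phi x => [|m IH] phi x /=; first by move=> ->.
move=> [g [h ig Eg]]; exists (fun z => y * g z); split.
- by move=> z; exact: IH.
- exact: (integrableZl measurableT y ig).
- under eq_integral do rewrite EFinM.
  by rewrite (integralZl measurableT ig y) Eg.
Qed.

Lemma imean_sum (I : finType) m (phi : I -> seq T -> R) (x : I -> R) :
  (forall i, imean m (phi i) (x i)) ->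
  imean m (fun s => \sum_i phi i s) (\sum_i x i).
Proof.
move=> h; elim: (index_enum I) => [|i r IH].
  rewrite big_nil; apply: eq_imean (imean_cst m 0) => s _.
  by rewrite big_nil.
rewrite big_cons; apply: eq_imean (imeanD _ _ _ _ _ (h i) IH) => s _.
by rewrite big_cons.
Qed.

(** Tower property: the last [n] points are averaged first, for each fixed prefix of length [m]. *)
Lemma imean_cat m n phi psi x :
  (forall s, size s = m -> imean n (fun t => phi (s ++ t)) (psi s)) ->
  imean m psi x -> imean (m + n) phi x.
Proof.
elim: m phi psi x => [|m IH] phi psi x h /=; first by move=> <-; exact: (h [::]).
case=> g [k ig Eg]; exists g; split => // z; apply: IH (k z) => s sm.
by apply: (h (z :: s)); rewrite /= sm.
Qed.

Lemma iint_ge0 m (h : seq T -> \bar R) :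
  (forall s, 0 <= h s)%E -> (0 <= iint P m h)%E.
Proof.
elim: m h => [|m IH] h h0 //=; apply: integral_ge0 => z _.
by apply: IH => s.
Qed.

(** Replaces a possibly non-measurable [h] by a majorant with a known mean, one integral at a time;
    nonnegativity of [h] is what allows this. *)
Lemma iint_le_imean m (h : seq T -> \bar R) phi x :
  (forall s, 0 <= h s)%E -> (forall s, size s = m -> h s <= (phi s)%:E)%E ->
  imean m phi x -> (iint P m h <= x%:E)%E.
Proof.
elim: m h phi x => [|m IH] h phi x h0 hphi /=.
  by move=> <-; exact: hphi.
case=> g [k ig <-]; apply: ge0_le_integral_nonmeas => z.
  exact: iint_ge0.
by apply: IH (k z) => // s sm; apply: hphi; rewrite /= sm.
Qed.

Section Centered.
Variables (xi : T -> R) (V : R).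
Hypothesis ixi : P.-integrable setT (EFin \o xi).
Hypothesis Exi : (\int[P]_z (xi z)%:E = 0)%E.

(** The offset [x] stores the contribution of the points already drawn, which makes the induction on
    [m] close. *)
Lemma imean_sum_seq m x : imean m (fun s => x + \sum_(z <- s) xi z) x.
Proof.
elim: m x => [|m IH] x /=; first by rewrite big_nil addr0.
exists (fun z => x + xi z); split.
- by move=> z; apply: eq_imean (IH (x + xi z)) => s _; rewrite big_cons addrA.
- exact: (integrableD measurableT
    (finite_measure_integrable_cst P x measurableT) ixi).
- rewrite (integralD_EFin measurableT
    (finite_measure_integrable_cst P x measurableT) ixi)/=.
  by rewrite Exi adde0 integral_cst_probability.
Qed.

Hypothesis ixi2 : P.-integrable setT (EFin \o (fun z => xi z ^+ 2)).
Hypothesis Exi2 : (\int[P]_z (xi z ^+ 2)%:E = V%:E)%E.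

Lemma imean_sqr_sum_seq m x :
  imean m (fun s => (x + \sum_(z <- s) xi z) ^+ 2) (x ^+ 2 + m%:R * V).
Proof.
elim: m x => [|m IH] x /=; first by rewrite big_nil addr0 mul0r addr0.
(* One-point means bundle integrability and value, so the calculus of [imean] treats the expansion
   of [(x + xi z) ^+ 2]; its cross term vanishes because [xi] is centered. *)
have M1 : imean 1 (fun s => \sum_(z <- s) xi z) 0.
  by apply: eq_imean (imean_sum_seq 1 0) => s _; rewrite add0r.
have M2 : imean 1 (fun s => \sum_(z <- s) xi z ^+ 2) V.
  exists (fun z => xi z ^+ 2); split => // z /=.
  by rewrite big_cons big_nil addr0.
have M3 := imeanD _ _ _ _ _ (imeanD _ _ _ _ _ (imeanZ _ _ _ (2 * x) M1) M2)
  (imean_cst 1 (x ^+ 2 + m%:R * V)).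
case: M3 => g /= [h ig Eg]; exists g; split => //.
- move=> z; have := h z; rewrite !big_cons !big_nil !addr0 => <-.
  rewrite (_ : 2 * x * xi z + xi z ^+ 2 + (x ^+ 2 + m%:R * V) =
    (x + xi z) ^+ 2 + m%:R * V); last by ring.
  by apply: eq_imean (IH (x + xi z)) => s _; rewrite big_cons addrA.
- by rewrite Eg; congr (_%:E); rewrite -natr1; ring.
Qed.

End Centered.

(* Joint measurability in the [m] entries of the sequence, expressed by
   composition with arbitrary [m]-tuples of measurable functions. *)
Definition seq_measurable m phi := forall (d' : measure_display)
  (U : measurableType d') (z : nat -> U -> T),
  (forall i, measurable_fun setT (z i)) ->
  measurable_fun setT (fun u => phi (mkseq (z^~ u) m)).

(** Induction on the number [m] of points still to be integrated. The first [k] entries are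
    measurable functions of a parameter [u], and measurability of the partial mean in [u] comes from
    Tonelli's theorem. *)
Lemma imean_section (m k : nat) phi (B : R) :
  seq_measurable (k + m) phi ->
  (forall s, size s = (k + m)%N -> `|phi s| <= B) ->
  forall (d' : measure_display) (U : measurableType d') (z : nat -> U -> T),
  (forall i, measurable_fun setT (z i)) ->
  exists g : U -> R, [/\ measurable_fun setT g, forall u, `|g u| <= B &
    forall u, imean m (fun s => phi (mkseq (z^~ u) k ++ s)) (g u)].
Proof.
elim: m k => [|m IH] k mphi bphi d' U z mz.
  rewrite addn0 in mphi bphi.
  exists (fun u => phi (mkseq (z^~ u) k)); split; first exact: mphi.
    by move=> u; apply: bphi; rewrite size_mkseq.
  by move=> u /=; rewrite cats0.
rewrite addnS -addSn in mphi bphi.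
(* The next point becomes a parameter: the space grows to [U * T], and its second coordinate is
   entry [k]. *)
pose z' i (ut : U * T) := if (i < k)%N then z i ut.1 else ut.2.
have mz' i : measurable_fun setT (z' i).
  rewrite /z'; case: (i < k)%N; last exact: measurable_snd.
  exact: (measurableT_comp (mz i) measurable_fst).
have [g' [mg' bg' h]] := IH _ mphi bphi _ _ z' mz'.
have ez u t : mkseq (z'^~ (u, t)) k.+1 = rcons (mkseq (z^~ u) k) t.
  rewrite mkseqS {2}/z' ltnn; congr rcons; apply/eq_in_map => i.
  by rewrite mem_iota /= add0n /z' => ->.
have sec u : measurable_fun setT (fun t => g' (u, t)).
  exact: measurableT_comp mg' (measurable_pair1 u).
have isec u : P.-integrable setT (EFin \o (fun t => g' (u, t))).
  apply: (le_integrable measurableT _ _ (finite_measure_integrable_cst P B measurableT)).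
    exact/measurable_EFinP.
  by move=> t _ /=; rewrite lee_fin (le_trans (bg' _))// ler_norm.
have icst := finite_measure_integrable_cst P B measurableT.
(* Tonelli asks for a nonnegative integrand, so [g'] is shifted by its bound [B], which is
   subtracted afterwards. *)
have Eadd u : (\int[P]_t (g' (u, t) + B)%:E = \int[P]_t (g' (u, t))%:E + B%:E)%E.
  rewrite (integralD_EFin measurableT (isec u) icst)/=.
  by rewrite integral_cst_probability.
have fin u := integrable_fin_num measurableT (isec u).
exists (fun u => fine (\int[P]_t (g' (u, t))%:E)); split.
- apply/measurable_EFinP.
  have -> : EFin \o (fun u => fine (\int[P]_t (g' (u, t))%:E)) =
      (fun u => fubini_F P (fun ut => (g' ut + B)%:E) u - B%:E)%E.
    apply/funext => u /=; rewrite fineK ?fin// /fubini_F Eadd.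
    by rewrite addeK.
  apply: emeasurable_funB; last exact: measurable_cst.
  apply: measurable_fun_fubini_tonelli_F.
    by apply/measurable_EFinP; apply: measurable_funD mg' _; exact: measurable_cst.
  by move=> ut; rewrite lee_fin -lerBlDr sub0r; have := bg' ut; rewrite ler_norml => /andP[].
- move=> u; rewrite -lee_fin.
  have -> : (`|fine (\int[P]_t (g' (u, t))%:E)|%:E = `| \int[P]_t (g' (u, t))%:E |)%E.
    by rewrite -[in RHS](fineK (fin u)).
  apply: le_trans (le_abse_integral P measurableT (measurable_int P (isec u))) _.
  have -> : B%:E = (\int[P]_t B%:E)%E by rewrite integral_cst_probability.
  by apply: ge0_le_integral_nonmeas => t //=; rewrite lee_fin.
- move=> u; exists (fun t => g' (u, t)); split => //; last by rewrite fineK ?fin.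
  move=> t; have := h (u, t); rewrite ez.
  by apply: eq_imean => s _; rewrite cat_rcons.
Qed.

Lemma imean_bounded m phi (B : R) : seq_measurable m phi ->
  (forall s, size s = m -> `|phi s| <= B) -> exists x, imean m phi x.
Proof.
case: m => [|m] mphi bphi; first by exists (phi [::]).
have [g [_ _ h]] := imean_section m.+1 0 phi B mphi bphi _ T (fun _ => id)
  (fun _ => @measurable_id _ T setT).
(* With an empty prefix any point of [T] serves as parameter; if [T] is empty, the pointwise
   condition is vacuous. *)
case: (pselect (exists t : T, True)) => [[t _]|nT]; first by exists (g t); exact: (h t).
exists 0; exists (fun=> 0); split.
- by move=> z; exfalso; apply: nT; exists z.
- exact: (finite_measure_integrable_cst P 0 measurableT).
- by rewrite integral0.
Qed.

End IteratedMean.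

(** * Measurability of the matrix inverse *)

Section MeasurableInverse.
Context {R : realType} {dU : measure_display} {U : measurableType dU}.

Lemma measurable_fun_inv (g : U -> R) :
  measurable_fun setT g -> measurable_fun setT (fun u => (g u)^-1).
Proof.
(* Reduces to a real power of [g ^+ 2 >= 0]; where [g] vanishes both sides are 0, as [0^-1 = 0]. *)
move=> mg; have -> : (fun u => (g u)^-1) = (fun u => g u * (g u ^+ 2) `^ (-1)).
  apply/funext => u; rewrite powR_inv1 ?sqr_ge0//.
  have [->|g0] := eqVneq (g u) 0; first by rewrite invr0 mul0r.
  by rewrite expr2 invfM mulrA divff// mul1r.
apply: measurable_funM => //.
apply: (measurableT_comp (f := @powR R ^~ (-1))); first exact: measurable_powR.
exact: measurable_funX.
Qed.

Lemma measurable_fun_det n (A : U -> 'M[R]_n) :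
  (forall i j, measurable_fun setT (fun u => A u i j)) ->
  measurable_fun setT (fun u => \det (A u)).
Proof.
move=> mA; apply: measurable_sum => s; apply: measurable_funM.
  exact: measurable_cst.
by apply: measurable_prod => i _.
Qed.

(** Cramer's rule: each entry is a cofactor divided by the determinant. *)
Lemma measurable_fun_invmx n (A : U -> 'M[R]_n) i j :
  (forall u, A u \in unitmx) ->
  (forall i j, measurable_fun setT (fun u => A u i j)) ->
  measurable_fun setT (fun u => invmx (A u) i j).
Proof.
move=> uA mA.
have -> : (fun u => invmx (A u) i j) = (fun u => (\det (A u))^-1 *
    ((-1) ^+ (j + i) * \det (row' j (col' i (A u))))).
  by apply/funext => u; rewrite /invmx uA !mxE.
apply: measurable_funM; first exact/measurable_fun_inv/measurable_fun_det.
apply: measurable_funM; first exact: measurable_cst.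
apply: measurable_fun_det => k l.
by under eq_fun do rewrite !mxE; exact: mA.
Qed.

End MeasurableInverse.

(** * Mean of the one-step bound at a fixed iterate [w] *)

Section SampledStep.
Context {R : realType} {d : nat} {dT : measure_display} {T : measurableType dT}.
Variables (P : probability T R) (f : 'rV[R]_d -> T -> R).
Variables (L m M v : R) (beta : nat) (w : 'rV[R]_d).
Local Notation F := (Frisk P f).
Hypotheses (L0 : 0 < L) (m0 : 0 < m).
Hypothesis igrad : forall i, P.-integrable setT (fun z => (grad (f^~ z) w 0 i)%:E).
Hypothesis ihess : forall i j, P.-integrable setT (fun z => (hess (f^~ z) w i j)%:E).
Hypothesis Egrad : forall i,
  fine (\int[P]_z (grad (f^~ z) w 0 i)%:E) = grad F w 0 i.
Hypothesis Hbounds : forall s : seq T, size s = beta ->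
  mxle m%:M (hessS f s w) /\ mxle (hessS f s w) M%:M.
Hypothesis var_le :
  (\int[P]_z (\sum_i (grad (f^~ z) w 0 i - grad F w 0 i) ^+ 2)%:E <= (v ^+ 2)%:E)%E.

Lemma seq_measurable_invmx_hessS i j :
  seq_measurable beta (fun s => invmx (hessS f s w) i j).
Proof.
move=> d' U z mz; apply: measurable_fun_invmx => [u|k l].
  have [lH _] := Hbounds (mkseq (z^~ u) beta) (size_mkseq _ _).
  exact: mxle_unitmx m0 lH.
have -> : (fun u => hessS f (mkseq (z^~ u) beta) w k l) =
   (fun u => beta%:R^-1 * \sum_(i0 <- iota 0 beta) hess (f^~ (z i0 u)) w k l).
  by apply/funext => u; rewrite /hessS size_mkseq mxE summxE big_map.
apply: measurable_funM; first exact: measurable_cst.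
apply: measurable_sum => i0.
apply: (measurableT_comp (f := fun t => hess (f^~ t) w k l)) => //.
exact/measurable_EFinP/(measurable_int P (ihess k l)).
Qed.

Local Notation coef s := (noise_coef F L m (hessS f s w) w).

Lemma noise_coefE s i : coef s 0 i =
  \sum_k (- (m / L) * grad F w 0 k
          + m ^+ 2 / L * \sum_l grad F w 0 l * invmx (hessS f s w) l k)
         * invmx (hessS f s w) k i.
Proof. by rewrite mxE; apply: eq_bigr => k _; rewrite !mxE. Qed.

Lemma imean_noise_coef i : exists x, imean P beta (fun s => coef s 0 i) x.
Proof.
(* Triangle inequality in [noise_coefE], with every entry of the inverse bounded by [m^-1]. *)
pose B := \sum_k (`|- (m / L) * grad F w 0 k|
  + `|m ^+ 2 / L| * \sum_l `|grad F w 0 l| * m^-1) * m^-1.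
apply: (imean_bounded _ _ _ B) => [d' U z mz|s sb].
  under eq_fun do rewrite noise_coefE.
  apply: measurable_sum => k; apply: measurable_funM; last exact: seq_measurable_invmx_hessS.
  apply: measurable_funD; first exact: measurable_cst.
  apply: measurable_funM; first exact: measurable_cst.
  apply: measurable_sum => l; apply: measurable_funM; first exact: measurable_cst.
  exact: seq_measurable_invmx_hessS.
have [lH _] := Hbounds s sb; have Kle := invmx_entry_le m _ m0 lH.
rewrite noise_coefE; apply: le_trans (ler_norm_sum _ _ _) _.
apply: ler_sum => k _; rewrite normrM ler_pM//.
apply: le_trans (ler_normD _ _) _; rewrite lerD2l normrM ler_wpM2l//.
apply: le_trans (ler_norm_sum _ _ _) _; apply: ler_sum => l _.
by rewrite normrM ler_wpM2l.
Qed.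

Let xi i z := grad (f^~ z) w 0 i - grad F w 0 i.

Lemma integrable_noise i : P.-integrable setT (EFin \o xi i).
Proof.
exact: (integrableB measurableT (igrad i)
  (finite_measure_integrable_cst P (grad F w 0 i) measurableT)).
Qed.

Lemma integral_noise i : (\int[P]_z (xi i z)%:E = 0)%E.
Proof.
rewrite (integralB_EFin measurableT (igrad i)
  (finite_measure_integrable_cst P (grad F w 0 i) measurableT)) /=.
rewrite integral_cst_probability -Egrad fineK ?subee//.
  exact: (integrable_fin_num measurableT (igrad i)).
exact: (integrable_fin_num measurableT (igrad i)).
Qed.

(** The variance bound [var_le] makes the integral of this nonnegative function finite. *)
Lemma integrable_sum_sqr_noise :
  P.-integrable setT (EFin \o (fun z => \sum_i xi i z ^+ 2)).
Proof.
apply/integrableP; split.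
  apply/measurable_EFinP; apply: measurable_sum => i; apply: measurable_funX.
  exact/measurable_EFinP/(measurable_int P (integrable_noise i)).
apply: le_lt_trans (ltry (v ^+ 2)); apply: le_trans var_le.
rewrite le_eqVlt; apply/orP; left; apply/eqP; apply: eq_integral => z _ /=.
by rewrite ger0_norm// sumr_ge0// => i _; rewrite sqr_ge0.
Qed.

Lemma integrable_sqr_noise i : P.-integrable setT (EFin \o (fun z => xi i z ^+ 2)).
Proof.
apply: (le_integrable measurableT _ _ integrable_sum_sqr_noise).
  apply/measurable_EFinP; apply: measurable_funX.
  exact/measurable_EFinP/(measurable_int P (integrable_noise i)).
move=> z _ /=; rewrite lee_fin ger0_norm ?sqr_ge0//.
apply: le_trans (ler_norm _); rewrite (bigD1 i)//= lerDl.
by apply: sumr_ge0 => j _; rewrite sqr_ge0.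
Qed.

Let V i := fine (\int[P]_z (xi i z ^+ 2)%:E).

Lemma sum_variance_le : \sum_i V i <= v ^+ 2.
Proof.
rewrite -lee_fin; apply: le_trans var_le.
rewrite -sumEFin (eq_integral (fun z => \sum_i (xi i z ^+ 2)%:E)%E); last first.
  by move=> z _; rewrite sumEFin.
rewrite (integral_sum measurableT integrable_sqr_noise).
rewrite le_eqVlt; apply/orP; left; apply/eqP; apply: eq_bigr => i _.
by rewrite fineK// (integrable_fin_num measurableT (integrable_sqr_noise i)).
Qed.

Lemma gradS_noise n (s : seq T) i : (0 < n)%N -> size s = n ->
  (gradS f s w - grad F w) 0 i = n%:R^-1 * \sum_(z <- s) xi i z.
Proof.
move=> n0 sn; rewrite /gradS sn !mxE summxE /xi sumrB mulrBr; congr (_ - _).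
rewrite big_const_seq count_predT sn iter_addr_0 -[grad F w 0 i *+ n]mulr_natl mulKf//.
  by rewrite mxE.
by rewrite pnatr_eq0 -lt0n.
Qed.

(* The Hessian sample is integrated first: its only effect on the term linear in
   the gradient noise is to average the coefficients, and the noise is centered. *)
Lemma imean_noisy_bound n c : (0 < n)%N -> exists2 x,
  imean P (n + beta) (fun s => c
    + dot (gradS f (take n s) w - grad F w) (coef (drop n s))
    + (2 * L)^-1 * dot (gradS f (take n s) w - grad F w)
                       (gradS f (take n s) w - grad F w)) x
  & x <= c + v ^+ 2 / (2 * L * n%:R).
Proof.
move=> n0; have [u hu] := choice imean_noise_coef.
pose e s := gradS f s w - grad F w.
(* Here [u i] is the mean of the [i]-th coefficient over Hessian samples; it meets the zero mean of
   the error. The last sum is the variance of an average of [n] independent terms. *)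
exists (c + \sum_i u i * 0 + (2 * L)^-1 * \sum_i n%:R^-1 ^+ 2 * (n%:R * V i)).
  apply: (imean_cat _ _ _ _
    (fun s => c + \sum_i u i * e s 0 i + (2 * L)^-1 * \sum_i e s 0 i ^+ 2)).
    move=> s sn; apply: (eq_imean _ _ (fun t => c + \sum_i e s 0 i * coef t 0 i
      + (2 * L)^-1 * \sum_i e s 0 i ^+ 2)).
      move=> t _; rewrite take_size_cat// drop_size_cat// !dotE -/(e s).
      by congr (_ + _ * _); apply: eq_bigr => i _; rewrite expr2.
    apply: imeanD; last exact: imean_cst.
    apply: imeanD; first exact: imean_cst.
    apply: imean_sum => i; rewrite mulrC; exact: imeanZ.
  apply: imeanD; last first.
    apply/imeanZ/imean_sum => i.
    have := imean_sqr_sum_seq P _ _ (integrable_noise i) (integral_noise i)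
      (integrable_sqr_noise i) _ n 0.
    move=> /(_ (V i)); rewrite fineK; last first.
      exact: (integrable_fin_num measurableT (integrable_sqr_noise i)).
    move=> /(_ erefl); rewrite expr0n add0r => /(imeanZ _ _ _ _ (n%:R^-1 ^+ 2)).
    apply: eq_imean => s sn; rewrite add0r (gradS_noise n)//.
    by rewrite exprMn.
  apply: imeanD; first exact: imean_cst.
  apply: imean_sum => i; apply: imeanZ.
  have /(imeanZ _ _ _ _ n%:R^-1) :=
    imean_sum_seq P _ (integrable_noise i) (integral_noise i) n 0.
  rewrite mulr0; apply: eq_imean => s sn.
  by rewrite add0r (gradS_noise n).
rewrite big1 ?addr0 => [|i _]; last by rewrite mulr0.
rewrite lerD2l.
have -> : \sum_i n%:R^-1 ^+ 2 * (n%:R * V i) = n%:R^-1 * \sum_i V i.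
  rewrite mulr_sumr; apply: eq_bigr => i _.
  by rewrite expr2 -!mulrA mulKf// pnatr_eq0 -lt0n.
rewrite [leRHS]mulrC [(2 * L * _)^-1]invfM -mulrA.
rewrite ler_wpM2l ?invr_ge0 ?mulr_ge0// ?(ltW L0)//.
by rewrite ler_wpM2l ?invr_ge0// sum_variance_le.
Qed.

End SampledStep.

(** Symmetry of the inverse turns the column formula into a row formula. Taking the true gradient
    for [G] isolates the sampling error. *)
Lemma sn_stepE (R : realType) (d : nat) (dT : measure_display) (T : measurableType dT)
    (f : 'rV[R]_d -> T -> R) (a m : R) (n : nat) (w G : 'rV[R]_d) (s : seq T) :
  mxle m%:M (hessS f (drop n s) w) ->
  sn_step f a n w s =
    w - a *: ((G + (gradS f (take n s) w - G)) *m invmx (hessS f (drop n s) w)).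
Proof.
move=> lH; rewrite /sn_step trmx_mul trmxK (invmx_sym _ _ lH).
by rewrite [G + _]addrC subrK.
Qed.

(** * The scalar affine recursion and its geometric majorant *)

Section Recursion.
Context {R : realType}.
Variables (r : R) (noise : nat -> R).

(** This is the sum of [r^(n-1-i) noise (j+i)] over [i < n], peeled from the first step as in
    [Eiter]. *)
Fixpoint noise_sum (j n : nat) : R :=
  if n is n'.+1 then r ^+ n' * noise j + noise_sum j.+1 n' else 0.

(** By hypothesis [C rho^j] is a supersolution of [x -> r x + noise j], so it stays above the
    iterates. *)
Lemma noise_sum_le (C rho : R) : 0 <= r ->
  (forall j, r * (C * rho ^+ j) + noise j <= C * rho ^+ j.+1) ->
  forall n j x, x <= C * rho ^+ j -> r ^+ n * x + noise_sum j n <= C * rho ^+ (j + n).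
Proof.
move=> r0 hstep; elim=> [|n IH] j x hx /=; first by rewrite expr0 mul1r addr0 addn0.
rewrite [r ^+ n.+1]exprSr -mulrA addrA -mulrDr -addSnnS.
by apply: IH; apply: le_trans (hstep j); rewrite lerD2r ler_wpM2l.
Qed.

End Recursion.

Lemma batch_ge (R : realType) (eta : R) k : 0 < eta -> eta ^+ k <= (batch eta k)%:R.
Proof.
move=> eta0; have e0 : 0 < eta ^+ k by rewrite exprn_gt0.
apply: le_trans (ceil_ge _) _.
by rewrite /batch natr_absz ler_int ler_norm.
Qed.

Lemma batch_gt0 (R : realType) (eta : R) k : 0 < eta -> (0 < batch eta k)%N.
Proof.
by move=> eta0; rewrite -(ltr_nat R) (lt_le_trans _ (batch_ge _ _ k eta0))// exprn_gt0.
Qed.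

Lemma Eiter_ge0 (R : realType) (d : nat) (dT : measure_display)
    (T : measurableType dT) (P : probability T R)
    sz step (phi : 'rV[R]_d -> \bar R) j n w :
  (forall w, 0 <= phi w)%E -> (0 <= Eiter P sz step j n w phi)%E.
Proof.
by move=> h; elim: n j w => [|n IH] j w //=; apply: iint_ge0 => s; exact: IH.
Qed.

Theorem theorem2p1 (R : realType) (d : nat) (dT : measure_display)
  (T : measurableType dT) (P : probability T R)
  (f : 'rV[R]_d -> T -> R)
  (mu L : R) (mub Lb : nat -> R) (v eta : R) (beta : nat)
  (w0 wstar : 'rV[R]_d) :
  (* smooth loss *)
  (forall z, C2 (f^~ z)) ->
  (* the expected risk and the expectations of gradients/Hessians exist *)
  (forall w, P.-integrable setT (fun z => (f w z)%:E)) ->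
  (forall w i, P.-integrable setT (fun z => (grad (f^~ z) w 0 i)%:E)) ->
  (forall w i j, P.-integrable setT (fun z => (hess (f^~ z) w i j)%:E)) ->
  (* E[grad F_i(w)] = grad F(w),  E[hess F_i(w)] = hess F(w) *)
  (forall w i, fine (\int[P]_z (grad (f^~ z) w 0 i)%:E) = grad (Frisk P f) w 0 i) ->
  (forall w i j, fine (\int[P]_z (hess (f^~ z) w i j)%:E) = hess (Frisk P f) w i j) ->
  (* Assumption A1 *)
  C2 (Frisk P f) ->
  (forall b, (0 < b)%N -> 0 < mub b /\ mub b <= Lb b) ->
  (forall b (s : seq T), (0 < b)%N -> size s = b -> forall w,
      mxle (mub b)%:M (hessS f s w) /\ mxle (hessS f s w) (Lb b)%:M) ->
  (exists mubar Lbar : R, 0 < mubar /\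
      forall b, (0 < b)%N -> mubar <= mub b /\ Lb b <= Lbar) ->
  0 < mu -> mu <= L ->
  (forall w, mxle mu%:M (hess (Frisk P f) w) /\ mxle (hess (Frisk P f) w) L%:M) ->
  (* Assumption A2: tr Cov(grad F_i(w)) <= v^2 *)
  (forall w, (\int[P]_z (\sum_i (grad (f^~ z) w 0 i - grad (Frisk P f) w 0 i) ^+ 2)%:E
              <= (v ^+ 2)%:E)%E) ->
  (* w* is the minimizer of F *)
  (forall w, Frisk P f wstar <= Frisk P f w) ->
  1 < eta -> (0 < beta)%N ->
  forall k : nat,
    (Eiter P (fun j => batch eta j + beta)%N
       (fun j => sn_step f (mub beta / L) (batch eta j)) 0 k w0
       (fun w => (Frisk P f w - Frisk P f wstar)%:E)
     <= ((Num.max (Frisk P f w0 - Frisk P f wstar)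
                  (v ^+ 2 * Lb beta / (mu * mub beta)))
         * (Num.max (1 - mu * mub beta / (2 * L * Lb beta)) (eta^-1)) ^+ k)%:E)%E.
Proof.
move=> _ _ igrad ihess Egrad _ F2 mub_gt0 Hb _ mu0 muL F_hess var_le Fmin eta1 beta0 k.
set m := mub beta; set M := Lb beta; set F := Frisk P f.
have [m0 mM] : 0 < m /\ m <= M := mub_gt0 _ beta0.
have L0 : 0 < L by exact: lt_le_trans muL.
have M0 : 0 < M by exact: lt_le_trans mM.
have eta0 : 0 < eta by exact: lt_trans eta1.
pose r := 1 - mu * m / (L * M).
have r0 : 0 <= r by rewrite subr_ge0 ler_pdivrMr ?mulr_gt0// mul1r ler_pM// ltW.
pose noise j := v ^+ 2 / (2 * L * (batch eta j)%:R).
have Delta0 w : (0 <= (F w - F wstar)%:E)%E by rewrite lee_fin subr_ge0.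
(* Both [j] and [w] stay general, since [Eiter] peels off the first transition. The induction
   hypothesis is increasing in the gap at the next iterate, as [r >= 0], so [newton_step_le] can be
   inserted before averaging. *)
have Eiter_le n j w :
  (Eiter P (fun j => batch eta j + beta)%N (fun j => sn_step f (m / L) (batch eta j))
     j n w (fun w => (F w - F wstar)%:E)
   <= (r ^+ n * (F w - F wstar) + noise_sum r noise j n)%:E)%E.
  elim: n j w => [|n IH] j w /=; first by rewrite expr0 mul1r addr0.
  have [x hx xle] := imean_noisy_bound P f L m M v beta w L0 m0 (igrad w) (ihess w)
    (Egrad w) (fun s sb => Hb beta s beta0 sb w) (var_le w) (batch eta j)
    (r * (F w - F wstar)) (batch_gt0 _ eta j eta0).
  have hmean := imeanD _ _ _ _ _ _ (imeanZ _ _ _ _ (r ^+ n) hx)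
    (imean_cst P (batch eta j + beta) (noise_sum r noise j.+1 n)).
  apply: le_trans (iint_le_imean _ _ _ _ _ _ _ hmean) _.
  - by move=> s; exact: Eiter_ge0.
  - move=> s sn; apply: le_trans (IH _ _) _; rewrite lee_fin lerD2r ler_wpM2l ?exprn_ge0//.
    have sd : size (drop (batch eta j) s) = beta by rewrite size_drop sn addKn.
    have [lH Hu] := Hb beta _ beta0 sd w.
    rewrite (sn_stepE _ _ _ _ _ _ m _ _ (grad F w))//.
    exact: newton_step_le.
  - by rewrite lee_fin exprSr addrA -mulrA -mulrDr lerD2r ler_wpM2l// exprn_ge0.
apply: le_trans (Eiter_le k 0%N w0) _; rewrite lee_fin.
set C := Num.max _ _; set rho := Num.max _ _.
have C0 : 0 <= C by rewrite le_max -lee_fin Delta0.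
have rho0 : 0 <= rho by rewrite le_max invr_ge0 (ltW eta0) orbT.
apply: (noise_sum_le r noise C rho r0 _ k 0%N); last by rewrite expr0 mulr1 le_max lexx.
(* The contraction gap [1 - r] is split in two halves [q]: one absorbs the noise, the other leaves
   the factor [1 - q <= rho]. *)
move=> j; set q := mu * m / (2 * L * M).
have q0 : 0 <= q by rewrite ltW// divr_gt0 ?mulr_gt0.
have -> : r = 1 - q - q by rewrite /r /q; field; rewrite !gt_eqF.
have noise_le : noise j <= q * (C * rho ^+ j).
  have -> : noise j = v ^+ 2 / (2 * L) * (batch eta j)%:R^-1.
    by rewrite /noise invfM mulrA.
  rewrite mulrA ler_pM ?invr_ge0//; first by rewrite divr_ge0 ?sqr_ge0 ?mulr_ge0// ltW.
    (* The second argument of the maximum [C] is chosen for this: [v^2 / (2 L) <= q C]. *)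
    have -> : v ^+ 2 / (2 * L) = q * (v ^+ 2 * M / (mu * m)).
      by rewrite /q; field; rewrite !gt_eqF.
    by rewrite ler_wpM2l// le_max lexx orbT.
  (* The batch has at least [eta^j] points, and [1 / eta <= rho]. *)
  apply: (@le_trans _ _ (eta^-1 ^+ j)).
    by rewrite exprVn lef_pV2 ?posrE ?exprn_gt0 ?ltr0n ?batch_gt0// batch_ge.
  by rewrite lerXn2r ?nnegrE ?invr_ge0 ?(ltW eta0)// le_max lexx orbT.
rewrite exprS [leRHS]mulrCA; apply: (@le_trans _ _ ((1 - q) * (C * rho ^+ j))).
  by move: noise_le; lra.
by rewrite ler_wpM2r ?mulr_ge0 ?exprn_ge0// le_max lexx.
Qed.
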